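(* Let $N\geq 1$ be an integer, and let $\star$ be the causal product on $\mathbb{C}^{N\times N}$ determined by sets $T_n\subseteq\{0,\dots,n\}$ with $n\in T_n$ and permutations $\sigma_n:T_n\to T_n$, for $n=0,\dots,N-1$. Then for all positive semidefinite matrices $A=(a_{jk})_{j,k=0}^{N-1}$ and $B=(b_{jk})_{j,k=0}^{N-1}$ in $\mathbb{C}^{N\times N}$: (1) If $\sigma_n(n)=n$ for all $n=0,\dots,N-1$, then $$\det(A\star B)+\det(AB)\geq \det A\prod_{n=0}^{N-1}b_{nn}+\det B\prod_{n=0}^{N-1}a_{nn}.$$ (2) If $N\geq 2$ and $\sigma_n(n)\neq n$ for all $n=1,\dots,N-1$, then $$\det(A\star B)\geq \det A\prod_{n=0}^{N-1}b_{\sigma_n(n),\sigma_n(n)}+\det B\prod_{n=0}^{N-1}a_{\sigma_n^{-1}(n),\sigma_n^{-1}(n)}.$$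
   Context: Rows and columns of $N\times N$ matrices are indexed by $0,1,\dots,N-1$. A matrix $A\in\mathbb{C}^{N\times N}$ is positive semidefinite if $z^*Az\geq 0$ for all $z\in\mathbb{C}^N$. For every $n=0,\dots,N-1$ fix a set $T_n\subseteq\{0,\dots,n\}$ with $n\in T_n$ and a permutation (bijection) $\sigma_n:T_n\to T_n$. The associated causal product of $A=(a_{jk})$ and $B=(b_{jk})$ in $\mathbb{C}^{N\times N}$ is the matrix $A\star B\in\mathbb{C}^{N\times N}$ with entries $$(A\star B)_{jk}:=\sum_{(p,q)\in T_j\times T_k}a_{p,q}\,b_{\sigma_j(p),\sigma_k(q)},\qquad 0\le j,k\le N-1.$$ Note that $T_0=\{0\}$ and $\sigma_0(0)=0$ necessarily. *)

(* Defs.v *)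
From HB Require Import structures.
From mathcomp Require Import all_boot all_order all_fingroup all_algebra.
From mathcomp Require Import complex reals.

Set Implicit Arguments.
Unset Strict Implicit.
Unset Printing Implicit Defensive.

Import Order.TTheory GRing.Theory Num.Theory.

Local Open Scope ring_scope.
Local Open Scope complex_scope.
Local Open Scope sesquilinear_scope.

(* In R[i], [0 <= x] means that the imaginary part of x is zero and its real
   part is nonnegative. *)
Definition psd (R : realType) (N : nat) (A : 'M[R[i]]_N) : Prop :=
  forall z : 'cV[R[i]]_N, 0 <= (z ^t* *m A *m z) 0 0.

(* A bijection of T n onto itself is encoded as the permutation of 'I_N that
   extends it by the identity outside T n (this is [perm_on]). *)
Definition causal_family (N : nat)
    (T : 'I_N -> {set 'I_N}) (sigma : 'I_N -> {perm 'I_N}) : Prop :=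
  forall n : 'I_N,
    [/\ forall p : 'I_N, p \in T n -> (p <= n)%N,
        n \in T n
      & perm_on (T n) (sigma n)].

Definition causal_prod (R : realType) (N : nat)
    (T : 'I_N -> {set 'I_N}) (sigma : 'I_N -> {perm 'I_N})
    (A B : 'M[R[i]]_N) : 'M[R[i]]_N :=
  \matrix_(j, k) \sum_(p in T j) \sum_(q in T k)
     A p q * B (sigma j p) (sigma k q).

(* Main.v *)
(* Let E be the diagonal unit matrix of the last index k of the leading blocks
   A_k, B_k. Each pivot of A, the scalar a with det A_k = a det A_(k-1), keeps
   A_k - a E positive semidefinite, and so does the pivot b of B. By causality,
   (A_k - a E) * (B_k - b E) differs from the leading block of A * B by a
   multiple t E, and a causal product of positive semidefinite matrices is positive
   semidefinite, as a sum of Gram matrices. Hence det (A * B)_k >= t det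
   (A * B)_(k-1), where t = a b_kk + b a_kk - a b if sigma_k fixes k, and
   t = a b_(s k, s k) + b a_(s^-1 k, s^-1 k) otherwise. Both inequalities follow
   by induction on k. *)
Require Import Defs.
From HB Require Import structures.
From mathcomp Require Import all_boot all_order all_fingroup all_algebra.
From mathcomp Require Import complex reals.
From mathcomp Require Import ring.

Set Implicit Arguments.
Unset Strict Implicit.
Unset Printing Implicit Defensive.

Import Order.TTheory GRing.Theory Num.Theory.

Local Open Scope ring_scope.
Local Open Scope complex_scope.
Local Open Scope sesquilinear_scope.

(** * Positive semidefinite matrices and their Gram factorizations *)

(* The predicate [psd] over an arbitrary [numClosedFieldType], so that no proof
   has to unfold the structure instances of [R[i]]; likewise for [causal_mx] and
   [causal_prod] below. *)
Definition psdmx (C : numClosedFieldType) n (A : 'M[C]_n) : Prop :=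
  forall z : 'cV[C]_n, 0 <= (z ^t* *m A *m z) 0 0.

Lemma adjmx_mul (C : numClosedFieldType) m n p
    (A : 'M[C]_(m, n)) (B : 'M[C]_(n, p)) :
  (A *m B) ^t* = B ^t* *m A ^t*.
Proof. by rewrite trmx_mul map_mxM. Qed.

(** Polarization: testing on e_i + c e_j leaves c D_ij + c^* D_ji = 0, and c = 1, c = i together
    force D_ij = 0. *)
Lemma quadratic_form_eq0 (C : numClosedFieldType) n (D : 'M[C]_n) :
  (forall z : 'cV[C]_n, z ^t* *m D *m z = 0) -> D = 0.
Proof.
move=> D0.
have eDe i j : delta_mx 0 i *m D *m delta_mx j (0 : 'I_1) = (D i j)%:M.
  by rewrite -rowE -colE; apply/matrixP => a b; rewrite !mxE !ord1.
have polar (c : C) i j : c * D i j + c^* * D j i = 0.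
  have := D0 (delta_mx i 0 + c *: delta_mx j 0).
  have -> : (delta_mx i 0 + c *: delta_mx j (0 : 'I_1)) ^t* =
            delta_mx 0 i + c^* *: delta_mx 0 j.
    apply/matrixP => a b.
    by rewrite !mxE rmorphD rmorphM !rmorph_nat !ord1 eqxx /= !andbT.
  rewrite !mulmxDl !mulmxDr -!scalemxAr -!scalemxAl !eDe => /matrixP.
  move=> /(_ 0 0); rewrite !mxE eqxx !mulr1n.
  have /matrixP/(_ 0 0) := D0 (delta_mx i 0).
  rewrite trmx_delta map_delta_mx eDe !mxE eqxx !mulr1n => ->.
  have /matrixP/(_ 0 0) := D0 (delta_mx j 0).
  rewrite trmx_delta map_delta_mx eDe !mxE eqxx !mulr1n => ->.
  by rewrite !mulr0 addr0 add0r.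
apply/matrixP => i j; rewrite mxE.
have := polar 1 i j; have := polar 'i%R i j.
rewrite conjCi rmorph1 !mul1r mulNr => /eqP; rewrite subr_eq0.
move=> /eqP/(mulfI (neq0Ci C)) <- /eqP.
by rewrite -mulr2n mulrn_eq0 /= => /eqP.
Qed.

(** The form of [A] takes real values, so the form of [A ^t* - A] vanishes identically. *)
Lemma psdmx_herm (C : numClosedFieldType) n (A : 'M[C]_n) :
  psdmx A -> A ^t* = A.
Proof.
move=> Apsd; apply/eqP; rewrite -subr_eq0; apply/eqP.
apply: quadratic_form_eq0 => z; rewrite mulmxBr mulmxBl; apply/eqP.
rewrite subr_eq0; apply/eqP.
have -> : z ^t* *m A ^t* *m z = (z ^t* *m A *m z) ^t*.
  by rewrite !adjmx_mul trmxCK mulmxA.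
apply/matrixP => i j; rewrite !ord1 !mxE; apply: CrealP.
by apply: ger0_real; have := Apsd z; rewrite mxE.
Qed.

Lemma psdmx_gram (C : numClosedFieldType) m n (G : 'M[C]_(m, n)) :
  psdmx (G ^t* *m G).
Proof.
move=> z; rewrite mulmxA -adjmx_mul -mulmxA mxE.
by apply: sumr_ge0 => i _; rewrite !mxE mulrC mul_conjC_ge0.
Qed.

(** By the spectral theorem A = P^* D P. Each eigenvalue is the value of the form at an eigenvector,
    so D has a real square root and G = D^(1/2) P. *)
Lemma psdmx_factor (C : numClosedFieldType) n (A : 'M[C]_n) :
  psdmx A -> exists G : 'M[C]_n, A = G ^t* *m G.
Proof.
move=> Apsd.
have /hermitian_normalmx/orthomx_spectralP: A \is hermsymmx.
  by apply/is_hermitianmxP; rewrite expr0 scale1r psdmx_herm.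
set P := spectralmx A; set d := spectral_diag A => defA.
have Pu : P \is unitarymx by apply: spectral_unitarymx.
rewrite invmx_unitary // in defA.
have d_ge0 i : 0 <= d 0 i.
  have := Apsd (P ^t* *m delta_mx i 0).
  rewrite adjmx_mul trmxCK trmx_delta map_delta_mx defA -!mulmxA.
  rewrite [P *m (P ^t* *m _)]mulmxA (unitarymxP Pu) mul1mx.
  rewrite [P *m (P ^t* *m _)]mulmxA (unitarymxP Pu) mul1mx.
  by rewrite -rowE -colE !mxE eqxx mulr1n.
exists (diag_mx (map_mx sqrtC d) *m P).
rewrite adjmx_mul tr_diag_mx map_diag_mx -mulmxA [diag_mx _ *m (_ *m _)]mulmxA.
rewrite mulmx_diag mulmxA {1}defA; congr (_ *m diag_mx _ *m _).
apply/rowP => i; rewrite !mxE /= geC0_conj ?sqrtC_ge0 //.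
by rewrite -expr2 sqrtCK.
Qed.

Lemma psdmx_det_ge0 (C : numClosedFieldType) n (A : 'M[C]_n) :
  psdmx A -> 0 <= \det A.
Proof.
move=> /psdmx_factor[G ->].
by rewrite det_mulmx det_map_mx det_tr mulrC mul_conjC_ge0.
Qed.

Lemma psdmx_mxsub (C : numClosedFieldType) m n (f : 'I_m -> 'I_n)
    (A : 'M[C]_n) :
  psdmx A -> psdmx (mxsub f f A).
Proof.
move=> /psdmx_factor[G ->].
suff -> : mxsub f f (G ^t* *m G) = (colsub f G) ^t* *m colsub f G.
  exact: psdmx_gram.
by rewrite mxsub_mul trmx_mxsub map_mxsub.
Qed.

Lemma psdmx_diag_ge0 (C : numClosedFieldType) n (A : 'M[C]_n) i :
  psdmx A -> 0 <= A i i.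
Proof.
move=> /(_ (delta_mx i 0)).
by rewrite trmx_delta map_delta_mx -rowE -colE !mxE.
Qed.

(** With A = G^* G the form is the squared norm of G z, so it vanishes only if G z = 0. *)
Lemma psdmx_isotropic (C : numClosedFieldType) n (A : 'M[C]_n) (z : 'cV_n) :
  psdmx A -> (z ^t* *m A *m z) 0 0 = 0 -> A *m z = 0.
Proof.
move=> /psdmx_factor[G ->]; rewrite mulmxA -adjmx_mul -mulmxA mxE.
move=> /eqP; rewrite psumr_eq0 => [/allP Gz0|i _]; last first.
  by rewrite !mxE mulrC mul_conjC_ge0.
rewrite -mulmxA; suff -> : G *m z = 0 by rewrite mulmx0.
apply/colP => i; have := Gz0 i (mem_index_enum i); rewrite !mxE mulrC.
by rewrite mul_conjC_eq0 => /eqP.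
Qed.

Lemma psdmx_sum (C : numClosedFieldType) n (I : finType) (F : I -> 'M[C]_n) :
  (forall i, psdmx (F i)) -> psdmx (\sum_i F i).
Proof.
move=> Fpsd z; rewrite mulmx_sumr mulmx_suml summxE.
by apply: sumr_ge0 => i _; apply: Fpsd.
Qed.

(** The index maps [f] and [g] are arbitrary so that the lemma applies to leading blocks, whose
    indices live in a smaller ordinal type. *)
Lemma psdmx_product (C : numClosedFieldType) (I : finType) m n l
    (S : 'I_l -> {set I}) (f : 'I_l -> I -> 'I_m) (g : 'I_l -> I -> 'I_n)
    (A : 'M[C]_m) (B : 'M[C]_n) :
  psdmx A -> psdmx B ->
  psdmx (\matrix_(j, k) \sum_(p in S j) \sum_(q in S k)
           A (f j p) (f k q) * B (g j p) (g k q)).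
Proof.
move=> /psdmx_factor[G ->] /psdmx_factor[H ->].
(* One row vector per pair of a row of [G] and a row of [H]; the matrix is the sum of the Gram
   matrices w^* w. *)
pose w rs : 'rV[C]_l := \row_k \sum_(q in S k) G rs.1 (f k q) * H rs.2 (g k q).
suff -> : (\matrix_(j, k) \sum_(p in S j) \sum_(q in S k)
      (G ^t* *m G) (f j p) (f k q) * (H ^t* *m H) (g j p) (g k q)) =
    \sum_rs (w rs) ^t* *m w rs.
  by apply: psdmx_sum => ?; apply: psdmx_gram.
apply/matrixP => j k; rewrite mxE summxE.
pose F rs p q := (G rs.1 (f j p) * H rs.2 (g j p))^* *
  (G rs.1 (f k q) * H rs.2 (g k q)).
transitivity (\sum_rs \sum_(p in S j) \sum_(q in S k) F rs p q).
  rewrite [RHS]exchange_big; apply: eq_bigr => p _.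
  rewrite [RHS]exchange_big; apply: eq_bigr => q _.
  rewrite !mxE big_distrlr pair_bigA /=; apply: eq_bigr => rs _.
  by rewrite !mxE /F rmorphM /=; ring.
apply: eq_bigr => rs _; rewrite mxE big_ord1 !mxE rmorph_sum mulr_suml.
by apply: eq_bigr => p _; rewrite mulr_sumr.
Qed.

(** * Diagonal perturbations and pivots *)

Lemma det_add_delta_diag (K : comNzRingType) n (i : 'I_n.+1) t
    (A : 'M[K]_n.+1) :
  \det (A + t *: delta_mx i i) = \det A + t * \det (row' i (col' i A)).
Proof.
rewrite (expand_det_row _ i) (expand_det_row A i) (bigD1 i) //=.
rewrite [in RHS](bigD1 i) //= !mxE !eqxx mulr1.
(* Cofactors along row i delete the only row that the perturbation touches. *)
have cof j : cofactor (A + t *: delta_mx i i) i j = cofactor A i j.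
  rewrite /cofactor; congr (_ * \det _); apply/matrixP => a b.
  by rewrite !mxE [lift i a == i]eq_sym (negbTE (neq_lift _ _)) mulr0 addr0.
rewrite cof mulrDl -addrA [t * _ + _]addrC addrA; congr (_ + _ + _).
  apply: eq_bigr => j ji; rewrite cof !mxE eqxx (negbTE ji) /=.
  by rewrite mulr0 addr0.
by rewrite /cofactor addnn -mul2n exprM sqrrN !expr1n mul1r.
Qed.

(* The vector [v] is [A]-orthogonal to the hyperplane [z i = 0]; the scalar [a]
   is the Schur complement of index [i], which this characterization defines
   even when the complementary block is singular. *)
Lemma psdmx_orthogonal_vector (C : numClosedFieldType) n (A : 'M[C]_n) i :
  psdmx A ->
  exists (v : 'cV[C]_n) (a : C), v i 0 = 1 /\ A *m v = a *: delta_mx i 0.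
Proof.
move=> Apsd; have Aherm := psdmx_herm Apsd.
(* If e_i lies in the row space, some u^* satisfies A u^* = e_i. Its entry i is nonzero, since
   otherwise u^* would be isotropic and A u^* = 0; so it can be normalized. *)
have [/submxP[u du] | ] := boolP (delta_mx (0 : 'I_1) i <= A)%MS.
  have Au : A *m u ^t* = delta_mx i 0.
    by rewrite -{1}Aherm -adjmx_mul -du trmx_delta map_delta_mx.
  have ui : (u ^t*) i 0 != 0.
    apply/eqP => ui0; have : A *m u ^t* = 0.
      apply: psdmx_isotropic => //.
      rewrite -mulmxA Au trmxCK -colE mxE; apply/eqP.
      by move/eqP: ui0; rewrite !mxE conjC_eq0.
    rewrite Au => /matrixP/(_ i 0)/eqP.
    by rewrite !mxE !eqxx oner_eq0.
  exists (((u ^t*) i 0)^-1 *: u ^t*), (((u ^t*) i 0)^-1); split.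
    by rewrite mxE mulVf.
  by rewrite -scalemxAr Au.
(* Otherwise the kernel of A contains a vector with nonzero entry i, and a = 0 works. *)
rewrite submxE -rowE => /rV0Pn[j]; rewrite mxE => kij.
exists ((cokermx A i j)^-1 *: col j (cokermx A)), 0; split.
  by rewrite mxE [col _ _ _ _]mxE mulVf.
by rewrite -scalemxAr colE mulmxA mulmx_coker mul0mx scaler0 scale0r.
Qed.

(** With E the unit matrix at (i, i), v spans a null direction of A - a E. Writing z = u + z_i v
    with u_i = 0, the form of A - a E at z is that of A at u, hence nonnegative. Also det (A - a E)
    = 0, and expanding it gives the formula for det A. *)
Lemma psdmx_pivot (C : numClosedFieldType) n (A : 'M[C]_n.+1) i :
  psdmx A ->
  exists a : C, [/\ 0 <= a <= A i i, psdmx (A - a *: delta_mx i i)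
                  & \det A = a * \det (row' i (col' i A))].
Proof.
move=> Apsd; have Aherm := psdmx_herm Apsd.
have [v [a [vi Av]]] := psdmx_orthogonal_vector i Apsd.
have vadj : (v ^t*) 0 i = 1 by rewrite !mxE vi rmorph1.
have a_ge0 : 0 <= a.
  by have := Apsd v; rewrite -mulmxA Av -scalemxAr mxE -colE mxE vadj mulr1.
have A0v : (A - a *: delta_mx i i) *m v = 0.
  rewrite mulmxBl Av -scalemxAl -scalerBr; apply/eqP; rewrite scaler_eq0.
  apply/orP; right; rewrite subr_eq0; apply/eqP/colP => j.
  rewrite -[in RHS](mul_delta_mx (0 : 'I_1)) -mulmxA -rowE.
  rewrite [row i v](_ : _ = 1%:M) ?mulmx1 //.
  by apply/rowP => k; rewrite !ord1 !mxE vi eqxx.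
have a_herm : (A - a *: delta_mx i i) ^t* = A - a *: delta_mx i i.
  rewrite -{2}Aherm; apply/matrixP => j k.
  rewrite !mxE rmorphB rmorphM rmorph_nat [(k == _) && _]andbC.
  by rewrite /= (geC0_conj a_ge0).
have vA0 : v ^t* *m (A - a *: delta_mx i i) = 0.
  by rewrite -a_herm -adjmx_mul A0v trmx0 map_mx0.
have A0psd : psdmx (A - a *: delta_mx i i).
  move=> z.
  have [u ui zE] : exists2 u : 'cV_n.+1, u i 0 = 0 & z = u + z i 0 *: v.
    by exists (z - z i 0 *: v); rewrite ?subrK // !mxE vi mulr1 subrr.
  have zadj : z ^t* = u ^t* + (z i 0)^* *: v ^t*.
    by rewrite {1}zE; apply/matrixP => j k; rewrite !mxE rmorphD rmorphM.
  have uEu : u ^t* *m (a *: delta_mx i i) *m u = 0.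
    rewrite -(mul_delta_mx (0 : 'I_1)) -mulmxA -scalemxAl -mulmxA -rowE.
    rewrite [row i u](_ : _ = 0) ?mulmx0 ?scaler0 ?mulmx0 //.
    by apply/rowP => k; rewrite ord1 !mxE.
  have -> : z ^t* *m (A - a *: delta_mx i i) *m z = u ^t* *m A *m u.
    rewrite -[RHS]subr0 -uEu -mulmxBl -mulmxBr {2}zE mulmxDr -scalemxAr.
    rewrite -[_ *m v]mulmxA A0v mulmx0 scaler0 addr0; congr (_ *m _).
    rewrite zadj mulmxDl -scalemxAl vA0.
    by rewrite scaler0 addr0.
  exact: Apsd.
exists a; split => //.
  rewrite a_ge0 -subr_ge0.
  by have := psdmx_diag_ge0 i A0psd; rewrite !mxE !eqxx mulr1.
have : \det (A - a *: delta_mx i i) = 0.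
  apply/eqP/det0P; exists (v ^t*) => //.
  by apply/rV0Pn; exists i; rewrite vadj oner_eq0.
rewrite -scaleNr det_add_delta_diag mulNr => /eqP.
by rewrite subr_eq0 => /eqP.
Qed.

(** * Leading blocks of the causal product *)

(** Using [inord] keeps k a free natural number, without casts in the inductions; the block is the
    genuine one for k <= n.+1. *)
Definition leading (K : Type) n k (M : 'M[K]_n.+1) : 'M[K]_k :=
  mxsub (fun i : 'I_k => inord i) (fun i : 'I_k => inord i) M.

Lemma leading_succ (K : Type) n k (M : 'M[K]_n.+1) :
  row' ord_max (col' ord_max (leading k.+1 M)) = leading k M.
Proof. by apply/matrixP => i j; rewrite !mxE !lift_max. Qed.

Lemma leading_full (K : Type) n (M : 'M[K]_n.+1) : leading n.+1 M = M.
Proof. by apply/matrixP => i j; rewrite !mxE !inord_val. Qed.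

Lemma sum_delta2 (K : nzRingType) (I : finType) (S : {set I}) (a : I)
    (F : I -> I -> K) :
  a \in S ->
  \sum_(p in S) \sum_(q in S) F p q * ((p == a) && (q == a))%:R = F a a.
Proof.
move=> aS; rewrite (bigD1 a) //= [X in _ + X]big1 => [|p /andP[_ /negbTE pa]].
  rewrite addr0 (bigD1 a) //= big1 => [|q /andP[_ /negbTE qa]].
    by rewrite !eqxx mulr1 addr0.
  by rewrite qa andbF mulr0.
by apply: big1 => q _; rewrite pa mulr0.
Qed.

Definition causal_mx (C : numClosedFieldType) N
    (T : 'I_N -> {set 'I_N}) (sigma : 'I_N -> {perm 'I_N})
    (A B : 'M[C]_N) : 'M[C]_N :=
  \matrix_(j, k) \sum_(p in T j) \sum_(q in T k)
     A p q * B (sigma j p) (sigma k q).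

(* The unit matrix [E] of index [k] is absorbed by the product on the leading
   blocks: [E * B = B (sigma k k) (sigma k k) *: E], [A * E = A h h *: E] and
   [E * E = (sigma k k == k)%:R *: E]. The matrix below is therefore the product
   of the two psd matrices of the hypotheses. *)
Lemma psdmx_causal_mx_pivot (C : numClosedFieldType) n
    (T : 'I_n.+1 -> {set 'I_n.+1}) (sigma : 'I_n.+1 -> {perm 'I_n.+1})
    (A B : 'M[C]_n.+1) (k : 'I_n.+1) (a b : C) :
  causal_family T sigma ->
  psdmx (leading k.+1 A - a *: delta_mx ord_max ord_max) ->
  psdmx (leading k.+1 B - b *: delta_mx ord_max ord_max) ->
  let h := ((sigma k)^-1)%g k in
  psdmx (leading k.+1 (causal_mx T sigma A B)
         - (a * B (sigma k k) (sigma k k) + b * A h h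
            - a * b * (sigma k k == k)%:R) *: delta_mx ord_max ord_max).
Proof.
move=> Tsigma A0 B0 h.
have := psdmx_product (fun j : 'I_k.+1 => T (inord j))
  (fun _ p => inord p) (fun j p => inord (sigma (inord j) p)) A0 B0.
congr psdmx; apply/matrixP => i j.
have inordE (x : 'I_n.+1) : (x <= k)%N -> inord (inord x : 'I_k.+1) = x.
  by move=> xk; apply: val_inj; rewrite /= !inordK // ltnS.
have maxE (x : 'I_n.+1) :
    (x <= k)%N -> ((inord x : 'I_k.+1) == ord_max) = (x == k).
  by move=> xk; rewrite -!val_eqE /= inordK.
have val_inord (c : 'I_k.+1) : (inord c : 'I_n.+1) = c :> nat.
  by rewrite inordK // (leq_trans (ltn_ord c)).
have ck (c : 'I_k.+1) : (c <= k)%N by rewrite -ltnS.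
(* Causality: row c only involves indices up to c, so passing between ['I_n.+1] and ['I_k.+1] by
   [inord] loses nothing. *)
have Tle (c : 'I_k.+1) x : x \in T (inord c) -> (x <= c)%N.
  by case: (Tsigma (inord c)) => /(_ x) + _ _ => /[apply]; rewrite val_inord.
have Tlek (c : 'I_k.+1) x : x \in T (inord c) -> (x <= k)%N.
  by move=> /Tle xc; apply: leq_trans xc _.
have Tsig c x : x \in T (inord c) -> sigma (inord c) x \in T (inord c).
  by case: (Tsigma (inord c)) => _ _ /perm_closed->.
have blockE (M : 'M[C]_n.+1) c (x y : 'I_n.+1) : (x <= k)%N -> (y <= k)%N ->
    (leading k.+1 M - c *: delta_mx ord_max ord_max) (inord x) (inord y)
    = M x y - c * ((x == k) && (y == k))%:R.
  by move=> xk yk; rewrite !mxE !inordE // !maxE.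
transitivity (\sum_(p in T (inord i)) \sum_(q in T (inord j))
   (A p q - a * ((p == k) && (q == k))%:R) *
   (B (sigma (inord i) p) (sigma (inord j) q)
    - b * ((sigma (inord i) p == k) && (sigma (inord j) q == k))%:R)).
  rewrite mxE; apply: eq_bigr => p pT; apply: eq_bigr => q qT.
  by rewrite !blockE // ?(Tlek _ _ pT) ?(Tlek _ _ qT) //; apply/Tlek/Tsig.
rewrite !mxE.
have [/andP[/eqP-> /eqP->]|nmax] := boolP ((i == ord_max) && (j == ord_max)).
  have -> : inord (ord_max : 'I_k.+1) = k by exact: inord_val.
  have [_ kT /perm_closed kclosed] := Tsigma k.
  have hT : h \in T k by rewrite -kclosed permKV.
  have sigE x : (sigma k x == k) = (x == h) by rewrite (canF_eq (permK _)).
  (* At the corner the product expands into the term of the causal product and three corrections,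
     supported at (k, k) or (h, h); the one carrying both indicators survives only if h = k. *)
  under eq_bigr => p pT.
    under eq_bigr => q qT.
      rewrite (_ : _ * _ = A p q * B (sigma k p) (sigma k q)
        - (a * B (sigma k p) (sigma k q)) * ((p == k) && (q == k))%:R
        - (b * A p q) * ((p == h) && (q == h))%:R
        + (a * b * ((p == k) && (q == k))%:R) * ((p == h) && (q == h))%:R);
        last by rewrite !sigE; ring.
      over.
    rewrite big_split /= sumrB sumrB; over.
  rewrite /= big_split /= sumrB sumrB !sum_delta2 // sigE andbb [k == h]eq_sym.
  by ring.
rewrite mulr0 subr0; apply: eq_bigr => p pT; apply: eq_bigr => q qT.
(* Off the corner the corrections vanish: k in T_i forces i = k. *)
have nk x y : x \in T (inord i) -> y \in T (inord j) ->
    (x == k) && (y == k) = false.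
  move=> xT yT; apply: contraNF nmax => /andP[/eqP xk /eqP yk].
  apply/andP; split; rewrite -val_eqE /= eqn_leq ck /=.
    by have := Tle _ _ xT; rewrite xk.
  by have := Tle _ _ yT; rewrite yk.
by rewrite !nk ?Tsig // !mulr0 !subr0.
Qed.

Lemma leading_pivot (C : numClosedFieldType) n (A : 'M[C]_n.+1) (k : 'I_n.+1) :
  psdmx A ->
  exists a : C, [/\ 0 <= a <= A k k,
    psdmx (leading k.+1 A - a *: delta_mx ord_max ord_max)
    & \det (leading k.+1 A) = a * \det (leading k A)].
Proof.
move=> Apsd; have := psdmx_pivot (ord_max : 'I_k.+1)
  (psdmx_mxsub (fun i : 'I_k.+1 => inord i) Apsd).
move=> [a []]; rewrite leading_succ mxE inord_val => a_bounds psd_a det_a.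
by exists a.
Qed.

Lemma det_leading_causal_mx (C : numClosedFieldType) n
    (T : 'I_n.+1 -> {set 'I_n.+1}) (sigma : 'I_n.+1 -> {perm 'I_n.+1})
    (A B : 'M[C]_n.+1) (k : 'I_n.+1) :
  causal_family T sigma -> psdmx A -> psdmx B ->
  let h := ((sigma k)^-1)%g k in
  let P := causal_mx T sigma A B in
  exists a b : C,
  [/\ 0 <= a <= A k k /\ \det (leading k.+1 A) = a * \det (leading k A),
      0 <= b <= B k k /\ \det (leading k.+1 B) = b * \det (leading k B)
    & (a * B (sigma k k) (sigma k k) + b * A h h
        - a * b * (sigma k k == k)%:R) * \det (leading k P)
      <= \det (leading k.+1 P)].
Proof.
move=> Tsigma Apsd Bpsd h P.
have [a [a_bounds A0 detA]] := leading_pivot k Apsd.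
have [b [b_bounds B0 detB]] := leading_pivot k Bpsd.
exists a, b; split; [by split | by split |].
have /psdmx_det_ge0 := psdmx_causal_mx_pivot Tsigma A0 B0.
by rewrite -scaleNr det_add_delta_diag leading_succ mulNr subr_ge0.
Qed.

(** * Induction on the size of the leading block *)

(** Scalar induction step when sigma_k fixes k: [al], [be] are the pivots, [a], [b] the diagonal
    entries, [dA], [dB], [d] the determinants of the previous blocks of A, B and their causal
    product, and [pA], [pB] the products of the previous diagonal entries. *)
Lemma oppenheim_step (C : numDomainType) (a b al be dA dB pA pB d : C) :
  0 <= al <= a -> 0 <= be <= b -> 0 <= dA <= pA -> 0 <= dB <= pB ->
  dA * pB + dB * pA <= d + dA * dB ->
  al * dA * (pB * b) + be * dB * (pA * a)
  <= (al * b + be * a - al * be) * d + al * dA * (be * dB).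
Proof.
move=> /andP[al0 ala] /andP[be0 beb] /andP[dA0 dAp] /andP[dB0 dBp] dle.
rewrite -subr_ge0 in ala; rewrite -subr_ge0 in beb.
rewrite -subr_ge0 in dAp; rewrite -subr_ge0 in dBp.
rewrite -subr_ge0 in dle; rewrite -subr_ge0.
have a0 : 0 <= a by rewrite -[a](subrK al) addr_ge0.
(* With U = dA pB, V = dB pA, W = dA dB and u = al b, v = be a, w = al be, this
   is (U+V-W)(u+v-w) - (Uu+Vv-Ww) = (U-W)(v-w) + (V-W)(u-w). *)
rewrite (_ : _ - _ = (al * (b - be) + be * a)
    * (d + dA * dB - (dA * pB + dB * pA))
  + dA * (pB - dB) * (be * (a - al)) + dB * (pA - dA) * (al * (b - be)));
  last by ring.
by do ![assumption | apply: mulr_ge0 | apply: addr_ge0].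
Qed.

Lemma oppenheim_causal_mx (C : numClosedFieldType) n
    (T : 'I_n.+1 -> {set 'I_n.+1}) (sigma : 'I_n.+1 -> {perm 'I_n.+1})
    (A B : 'M[C]_n.+1) :
  causal_family T sigma -> psdmx A -> psdmx B ->
  ((forall k, sigma k k = k) ->
     \det A * (\prod_k B k k) + \det B * (\prod_k A k k)
     <= \det (causal_mx T sigma A B) + \det (A *m B))
  /\
  ((0 < n)%N -> (forall k : 'I_n.+1, (0 < k)%N -> sigma k k <> k) ->
     \det A * (\prod_k B (sigma k k) (sigma k k))
     + \det B * (\prod_k A ((sigma k)^-1%g k) ((sigma k)^-1%g k))
     <= \det (causal_mx T sigma A B)).
Proof.
set P := causal_mx T sigma A B.
pose pr (F : 'I_n.+1 -> C) k := \prod_(i < k) F (inord i).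
have prS F (k : 'I_n.+1) : pr F k.+1 = pr F k * F k.
  by rewrite /pr big_ord_recr /= inord_val.
have prE F : \prod_(i < n.+1) F i = pr F n.+1.
  by apply: eq_bigr => i _; rewrite inord_val.
have invE k x : (((sigma k)^-1)%g x == x) = (sigma k x == x).
  by rewrite (canF_eq (permKV _)) eq_sym.
move=> Tsigma Apsd Bpsd; split=> [sigma_id | n_ge1 sigma_move].
  rewrite det_mulmx (prE (fun i => B i i)) (prE (fun i => A i i)).
  set pB := pr (fun i => B i i); set pA := pr (fun i => A i i).
  (* The induction also carries Hadamard's bounds on det A_k and det B_k, which [oppenheim_step]
     requires. *)
  suff main k : (k <= n.+1)%N ->
      [/\ 0 <= \det (leading k A) <= pA k, 0 <= \det (leading k B) <= pB k
        & \det (leading k A) * pB k + \det (leading k B) * pA k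
          <= \det (leading k P) + \det (leading k A) * \det (leading k B)].
    by have [] := main n.+1 (leqnn _); rewrite !leading_full.
  elim: k => [|k IH] kn.
    by rewrite !det_mx00 /pA /pB /pr !big_ord0 !mulr1 lexx ler01; split.
  have [dA dB dle] := IH (ltnW kn).
  have [a [b [[a_bounds ->] [b_bounds ->]]]] :=
    det_leading_causal_mx (Ordinal kn) Tsigma Apsd Bpsd.
  have /eqP -> : ((sigma (Ordinal kn))^-1)%g (Ordinal kn) == Ordinal kn.
    by rewrite invE sigma_id.
  rewrite sigma_id eqxx mulr1 => step.
  rewrite /pA /pB !(prS _ (Ordinal kn)) -/pA -/pB.
  have /andP[a0 ale] := a_bounds; have /andP[b0 ble] := b_bounds.
  have /andP[dA0 dAle] := dA; have /andP[dB0 dBle] := dB.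
  split.
  - by rewrite mulr_ge0 //= mulrC ler_pM.
  - by rewrite mulr_ge0 //= mulrC ler_pM.
  apply: le_trans (oppenheim_step a_bounds b_bounds dA dB dle) _.
  by rewrite lerD2r.
rewrite (prE (fun i => B (sigma i i) (sigma i i))).
rewrite (prE (fun i => A ((sigma i)^-1%g i) ((sigma i)^-1%g i))).
set FA := (fun i => A _ _); set FB := (fun i => B _ _).
have FA0 k : 0 <= FA k by apply: psdmx_diag_ge0.
have FB0 k : 0 <= FB k by apply: psdmx_diag_ge0.
pose U k := \det (leading k A) * pr FB k.
pose V k := \det (leading k B) * pr FA k.
(* At k = 0 the permutation fixes 0, so t = u + v - a b and only the bounds u <= t and v <= t
   remain. *)
have step (k : 'I_n.+1) : exists u v t : C,
    [/\ 0 <= u <= t, 0 <= v <= t, (0 < k)%N -> t = u + v,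
        U k.+1 = u * U k /\ V k.+1 = v * V k
      & t * \det (leading k P) <= \det (leading k.+1 P)].
  have [a [b [[/andP[a0 ale] dA] [/andP[b0 ble] dB]]]] :=
    det_leading_causal_mx k Tsigma Apsd Bpsd.
  rewrite -[A _ _]/(FA k) -[B _ _]/(FB k); set t := _ - _ => tle.
  exists (a * FB k), (b * FA k), t.
  have UV : U k.+1 = a * FB k * U k /\ V k.+1 = b * FA k * V k.
    by rewrite /U /V dA dB !prS; split; ring.
  have [k0 | k_gt0] := posnP k.
    have sk : sigma k k = k.
      have [Tk kT /perm_closed kclosed] := Tsigma k.
      have := Tk (sigma k k); rewrite kclosed => /(_ kT).
      by rewrite k0 leqn0 => /eqP sk0; apply: val_inj; rewrite /= sk0 k0.
    have tE : t = a * FB k + b * FA k - a * b by rewrite /t sk eqxx mulr1.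
    have /eqP hk : (sigma k)^-1%g k == k by rewrite invE sk.
    have FAE : FA k = A k k by rewrite /FA hk.
    have FBE : FB k = B k k by rewrite /FB sk.
    split=> //; rewrite mulr_ge0 //= tE -subr_ge0.
      rewrite (_ : _ - _ = b * (FA k - a)); last by ring.
      by rewrite mulr_ge0 // subr_ge0 FAE.
    rewrite (_ : _ - _ = a * (FB k - b)); last by ring.
    by rewrite mulr_ge0 // subr_ge0 FBE.
  have tE : t = a * FB k + b * FA k.
    by rewrite /t (negbTE (introN eqP (sigma_move k k_gt0))) mulr0 subr0.
  by split=> //; rewrite mulr_ge0 //= tE ?lerDl ?lerDr mulr_ge0.
(* Because of k = 0, U and V are bounded separately by det P_k, not by their sum. *)
have main k : (k <= n.+1)%N ->
    0 <= U k <= \det (leading k P) /\ 0 <= V k <= \det (leading k P).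
  elim: k => [|k IH] kn.
    by rewrite /U /V !det_mx00 /pr !big_ord0 !mulr1 lexx ler01; split.
  have [/andP[U0 Ule] /andP[V0 Vle]] := IH (ltnW kn).
  have [u [v [t [/andP[u0 ut] /andP[v0 vt] _ [-> ->]] tle]]] :=
    step (Ordinal kn).
  rewrite (mulr_ge0 u0 U0) (mulr_ge0 v0 V0) /=.
  by split; apply: le_trans tle; apply: ler_pM.
(* The sum appears only at the last index n > 0, where t = u + v: u U_n + v V_n <= (u + v) det
   P_n. *)
have [/andP[U0 Ule] /andP[V0 Vle]] := main n (leqnSn n).
have [u [v [t [/andP[u0 _] /andP[v0 _] tE [UE VE] tle]]]] :=
  step (ord_max : 'I_n.+1).
rewrite -(leading_full A) -(leading_full B) -(leading_full P).
rewrite -/(U n.+1) -/(V n.+1); rewrite UE VE.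
by apply: le_trans tle; rewrite tE // mulrDl lerD // ler_wpM2l.
Qed.

Theorem theorem6p2 (R : realType) (N : nat) (hN : (1 <= N)%N)
    (T : 'I_N -> {set 'I_N}) (sigma : 'I_N -> {perm 'I_N})
    (hTsigma : causal_family T sigma)
    (A B : 'M[R[i]]_N) (hA : psd A) (hB : psd B) :
  ((forall n : 'I_N, sigma n n = n) ->
     \det (causal_prod T sigma A B) + \det (A *m B) >=
     \det A * (\prod_(n < N) B n n) + \det B * (\prod_(n < N) A n n))
  /\
  ((2 <= N)%N ->
   (forall n : 'I_N, (1 <= n)%N -> sigma n n <> n) ->
     \det (causal_prod T sigma A B) >=
     \det A * (\prod_(n < N) B (sigma n n) (sigma n n))
     + \det B * (\prod_(n < N) A ((sigma n)^-1%g n) ((sigma n)^-1%g n))).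
Proof.
case: N hN T sigma hTsigma A B hA hB => // n _ T sigma Tsigma A B Apsd Bpsd.
exact: (oppenheim_causal_mx Tsigma Apsd Bpsd).
Qed.
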